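(* Consider the sender-receiver game $\Gamma$ with data $(K,p,M,X,(U^k)_{k\in K},(V^k)_{k\in K},(u_0^k)_{k\in K})$ described in the context. Assume that $|K|=2$. Then $\Gamma$ has a partitional equilibrium.
   Context: Data of the game $\Gamma$. $K$ is a nonempty finite set of types; $p\in\Delta(K)$ is a prior probability with $p^k>0$ for every $k\in K$; $M$ is a finite set of messages with $|M|\ge|K|$; $X$ is a compact (topological) space of decisions; for every $k\in K$, $U^k:X\to\mathbb{R}$ (sender, player 1) and $V^k:X\to\mathbb{R}$ (receiver, player 2) are continuous utility functions and $u_0^k\in\mathbb{R}$ is the sender's outside option. It is assumed that for every $k\in K$ there exists $x\in X$ with $U^k(x)\ge u_0^k$. ($\Delta(S)$ denotes the set of probability distributions on a finite set $S$.) Interpretation: a type $k$ is drawn from $p$ and told to the sender, who sends a message $m\in M$; the receiver then proposes $x\in X$; if the sender accepts, payoffs are $U^k(x),V^k(x)$; if he rejects (exit), he gets $u_0^k$ and the receiver gets $-\infty$. The sender of type $k$ accepts $x$ if and only if $U^k(x)\ge u_0^k$. The receiver's equilibrium expected utility is required to be finite. For $L\subseteq K$ let $X(L)=\{x\in X: U^k(x)\ge u_0^k \ \forall k\in L\}$. A strategy of the sender is a map $\sigma:K\to\Delta(M)$, written $\sigma(m\mid k)$; a strategy of the receiver is a map $\tau:M\to X$. Put $P_\sigma(m)=\sum_{k}p^k\sigma(m\mid k)$ and, if $P_\sigma(m)>0$, $p_m^k(\sigma)=p^k\sigma(m\mid k)/P_\sigma(m)$, $p_m(\sigma)=(p_m^k(\sigma))_{k\in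 K}\in\Delta(K)$, with support $\mathrm{supp}\,p_m(\sigma)\subseteq K$. An equilibrium of $\Gamma$ is a pair $(\sigma,\tau)$ such that (1) (incentive compatibility) $U^k(\tau(m))\ge U^k(\tau(m'))$ for all $k\in K$, all $m\in M$ with $\sigma(m\mid k)>0$ and all $m'\in M$; (2) (constrained optimization, no exit) for every $m\in M$ with $P_\sigma(m)>0$, $X(\mathrm{supp}\,p_m(\sigma))\ne\emptyset$ and $\tau(m)\in\arg\max_{x\in X(\mathrm{supp}\,p_m(\sigma))}\sum_{k}p_m^k(\sigma)V^k(x)$. An equilibrium is partitional if $\sigma$ is pure, i.e., for every $k\in K$, $\sigma(\cdot\mid k)$ is concentrated on a single message. *)

(* Defs.v *)
From mathcomp Require Import all_boot all_order all_algebra.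
From mathcomp Require Import all_classical all_reals all_analysis.

Set Implicit Arguments.
Unset Strict Implicit.
Unset Printing Implicit Defensive.

Import Order.TTheory GRing.Theory Num.Theory.
Import numFieldNormedType.Exports.

Local Open Scope classical_set_scope.
Local Open Scope ring_scope.

Definition Delta (R : realType) (S : finType) : set (S -> R) :=
  [set q | (forall s, 0 <= q s) /\ \sum_(s : S) q s = 1].

Arguments Delta R S : clear implicits.

(** [X] is not assumed to be Hausdorff or metrizable. *)
Record game (R : realType) (K M : finType) (X : topologicalType) := Game {
  prior : K -> R ;
  sender_utility : K -> X -> R ;
  receiver_utility : K -> X -> R ;
  outside_option : K -> R ;
  types_nonempty : (0 < #|K|)%N ;
  prior_dist : Delta R K prior ;
  prior_gt0 : forall k, 0 < prior k ;
  enough_messages : (#|K| <= #|M|)%N ;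
  decisions_compact : compact [set: X] ;
  sender_utility_continuous : forall k, continuous (sender_utility k) ;
  receiver_utility_continuous : forall k, continuous (receiver_utility k) ;
  individually_rational :
    forall k, exists x, outside_option k <= sender_utility k x
}.

Section Equilibrium.
Variables (R : realType) (K M : finType) (X : topologicalType).
Variable G : game R K M X.

Definition acceptable (L : {set K}) : set X :=
  [set x | forall k, k \in L -> outside_option G k <= sender_utility G k x].

Definition argmax (A : set X) (f : X -> R) : set X :=
  [set x | A x /\ forall y, A y -> f y <= f x].

(** In the following, [sigma k m] stands for sigma(m | k). *)

Definition message_prob (sigma : K -> M -> R) (m : M) : R :=
  \sum_(k : K) prior G k * sigma k m.

(** Only meaningful when [0 < message_prob sigma m]. *)
Definition posterior (sigma : K -> M -> R) (m : M) (k : K) : R :=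
  prior G k * sigma k m / message_prob sigma m.

Definition supp (q : K -> R) : {set K} := [set k | 0 < q k]%SET.

Definition sender_strategy (sigma : K -> M -> R) : Prop :=
  forall k, Delta R M (sigma k).

Definition incentive_compatible (sigma : K -> M -> R) (tau : M -> X) : Prop :=
  forall (k : K) (m : M), 0 < sigma k m ->
  forall m' : M, sender_utility G k (tau m') <= sender_utility G k (tau m).

(** No restriction is put on [tau m] at messages of probability zero.
    Exit, which costs the receiver -oo, is ruled out by the feasible set. *)
Definition constrained_optimal (sigma : K -> M -> R) (tau : M -> X) : Prop :=
  forall m : M, 0 < message_prob sigma m ->
  let q := posterior sigma m in
  acceptable (supp q) !=set0 /\
  argmax (acceptable (supp q))
         (fun x => \sum_(k : K) q k * receiver_utility G k x) (tau m).

Definition equilibrium (sigma : K -> M -> R) (tau : M -> X) : Prop :=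
  [/\ sender_strategy sigma,
      incentive_compatible sigma tau &
      constrained_optimal sigma tau].

Definition pure (sigma : K -> M -> R) : Prop :=
  forall k, exists m, sigma k m = 1 /\ forall m', m' != m -> sigma k m' = 0.

Definition partitional_equilibrium (sigma : K -> M -> R) (tau : M -> X) : Prop :=
  equilibrium sigma tau /\ pure sigma.

End Equilibrium.

(* Main.v *)
Require Import Defs.
From mathcomp Require Import all_boot all_order all_algebra.
From mathcomp Require Import all_classical all_reals all_analysis.

(** With two types there is always a pooling or a separating equilibrium,
according to whether some decision is acceptable to both types.

If [acceptable G setT] is nonempty, both types send the same message and the
receiver answers every message by a decision that maximises his prior expected
utility over that set.  A constant receiver strategy leaves the sender nothing
to gain from changing his message, so incentive compatibility is free.

If [acceptable G setT] is empty, each type sends a message of its own and the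
receiver answers type [k] by a maximiser of his utility over
[acceptable G [set k]].  What is acceptable to one type is then rejected by the
other, so imitation gives a type less than its outside option, while its own
message gives at least that: the conflict between the participation constraints
does the work of the incentive constraints.

The maximisers exist since acceptable sets are closed in a compact space
([acceptable_argmax_exists]).  Off-path messages are harmless, as the receiver
may answer them like some message that is sent ([pure_equilibrium]). *)

Set Implicit Arguments.
Unset Strict Implicit.
Unset Printing Implicit Defensive.

Import Order.TTheory GRing.Theory Num.Theory.
Import numFieldNormedType.Exports.

Local Open Scope classical_set_scope.
Local Open Scope ring_scope.

Section PureEquilibria.
Variables (R : realType) (K M : finType) (X : topologicalType).
Variable G : game R K M X.

Lemma weighted_sum_continuous (q : K -> R) :
  continuous (fun x => \sum_(k : K) q k * receiver_utility G k x).
Proof.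
elim: (index_enum K) => [|k s IH] x.
  under eq_fun do rewrite big_nil.
  exact: cvg_cst.
under eq_fun do rewrite big_cons.
apply: cvgD; last exact: IH.
by apply: cvgM; [exact: cvg_cst | exact: receiver_utility_continuous].
Qed.

Lemma acceptable_compact (L : {set K}) : compact (acceptable G L).
Proof.
have -> : acceptable G L = \bigcap_(k in [set k | k \in L])
    (sender_utility G k @^-1` [set r | outside_option G k <= r]).
  by [].
rewrite -[X in compact X]setTI.
apply: compact_closedI; first exact: (decisions_compact G).
apply: closed_bigI => k _; apply: preimage_closed; last exact: closed_ge.
by move=> x _; exact: sender_utility_continuous.
Qed.

Lemma acceptable_argmax_exists (L : {set K}) (q : K -> R) :
  acceptable G L !=set0 ->
  exists x, argmax (acceptable G L)
    (fun x => \sum_(k : K) q k * receiver_utility G k x) x.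
Proof.
move=> L0; have cont := @weighted_sum_continuous q.
have [x /set_mem Lx xmax] := compact_EVT_max L0 (@acceptable_compact L)
  (continuous_subspaceT cont).
by exists x; split=> // y Ly; apply: xmax; exact: mem_set.
Qed.

Definition pure_strategy (s : K -> M) (k : K) (m : M) : R := (m == s k)%:R.

Lemma pure_strategy_sender (s : K -> M) : sender_strategy (pure_strategy s).
Proof.
move=> k; split=> [m|]; first exact: ler0n.
rewrite (bigD1 (s k)) //= /pure_strategy eqxx big1 ?addr0 // => m.
by move/negPf->.
Qed.

Lemma pure_strategy_pure (s : K -> M) : pure (pure_strategy s).
Proof.
move=> k; exists (s k); rewrite /pure_strategy eqxx; split=> // m.
by move/negPf->.
Qed.

Lemma message_prob_pure_gt0 (s : K -> M) (k : K) :
  0 < message_prob G (pure_strategy s) (s k).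
Proof.
have ge0 j : 0 <= prior G j * pure_strategy s j (s k).
  by rewrite mulr_ge0 ?ler0n // ltW // prior_gt0.
rewrite /message_prob (bigD1 k) //= ltr_pwDl ?sumr_ge0 //.
by rewrite /pure_strategy eqxx mulr1 prior_gt0.
Qed.

Lemma message_prob_pureP (s : K -> M) (m : M) :
  0 < message_prob G (pure_strategy s) m -> exists k, m = s k.
Proof.
move=> m_gt0; apply: contrapT => /forallNP noK; move: m_gt0.
rewrite /message_prob big1 ?ltxx // => k _.
by rewrite /pure_strategy; case: eqP => [/noK|] //; rewrite mulr0.
Qed.

Lemma supp_posterior_pure (s : K -> M) (k : K) :
  supp (posterior G (pure_strategy s) (s k)) = [set j | s j == s k]%SET.
Proof.
apply/setP => j; rewrite !inE /posterior.
rewrite pmulr_lgt0 ?invr_gt0 ?message_prob_pure_gt0 //.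
by rewrite pmulr_rgt0 ?prior_gt0 // ltr0n lt0b eq_sym.
Qed.

(** A pure equilibrium may be described by the decision [x k] met by each type,
with constraints on the messages actually sent only: a message that no type
sends is answered like the message of an arbitrary type, which creates no new
deviation. *)
Lemma pure_equilibrium (s : K -> M) (x : K -> X) :
  (forall j k, s j = s k -> x j = x k) ->
  (forall k j, sender_utility G k (x j) <= sender_utility G k (x k)) ->
  (forall k, argmax (acceptable G [set j | s j == s k]%SET)
    (fun y => \sum_(j : K)
       posterior G (pure_strategy s) (s k) j * receiver_utility G j y) (x k)) ->
  exists sigma tau, partitional_equilibrium G sigma tau.
Proof.
move=> x_s ic opt; have /card_gt0P[k0 _] := types_nonempty G.
pose tau m := x (odflt k0 [pick j | s j == m]).
have tauE k : tau (s k) = x k.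
  rewrite /tau; case: pickP => [j /eqP /x_s // | /(_ k)].
  by rewrite eqxx.
exists (pure_strategy s), tau; split; last exact: pure_strategy_pure.
split; first exact: pure_strategy_sender.
  move=> k m; rewrite /pure_strategy ltr0n lt0b => /eqP-> m'.
  by rewrite tauE; exact: ic.
move=> m /message_prob_pureP[k ->] /=; rewrite supp_posterior_pure tauE.
by split; [exists (x k); case: (opt k) | exact: opt].
Qed.

(** A constant receiver strategy gives no type a reason to change its message,
so a common acceptable decision is the only requirement. *)
Lemma pooling_equilibrium :
  acceptable G [set: K]%SET !=set0 ->
  exists sigma tau, partitional_equilibrium G sigma tau.
Proof.
move=> acc; have K0 := types_nonempty G.
have /card_gt0P[m _] : (0 < #|M|)%N := leq_trans K0 (enough_messages G).
have [x xmax] :=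
  acceptable_argmax_exists (posterior G (pure_strategy (fun=> m)) m) acc.
apply: (@pure_equilibrium (fun=> m) (fun=> x)) => // k.
by have -> : [set j : K | m == m]%SET = [set: K]%SET
  by apply/setP => j; rewrite !inE eqxx.
Qed.

(** If no decision is acceptable to two distinct types, a type that imitates
another one is offered something worse than exit. *)
Lemma separating_equilibrium :
  (forall j k : K, j != k -> acceptable G [set j; k]%SET = set0) ->
  exists sigma tau, partitional_equilibrium G sigma tau.
Proof.
move=> disj.
pose s k : M := enum_val (widen_ord (enough_messages G) (enum_rank k)).
have s_inj : injective s.
  move=> j k /enum_val_inj /(congr1 val) /= /val_inj; exact: enum_rank_inj.
have /choice[x xmax] : forall k, exists x, argmax (acceptable G [set k]%SET)
    (fun y => \sum_(j : K)
       posterior G (pure_strategy s) (s k) j * receiver_utility G j y) x.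
  move=> k; apply: acceptable_argmax_exists.
  have [y ky] := individually_rational G k.
  by exists y => j; rewrite inE => /eqP->.
have x_acc k : outside_option G k <= sender_utility G k (x k).
  by case: (xmax k) => + _; apply; rewrite inE.
apply: (@pure_equilibrium s x) => [j k /s_inj-> // | k j | k].
  have [->//|jk] := eqVneq j k.
  apply: (le_trans _ (x_acc k)); rewrite leNgt; apply/negP => /ltW kxj.
  have : acceptable G [set j; k]%SET (x j).
    by move=> i; rewrite !inE => /orP[] /eqP->.
  by rewrite disj.
have -> : [set j | s j == s k]%SET = [set k]%SET.
  by apply/setP => j; rewrite !inE (inj_eq s_inj).
exact: xmax.
Qed.

End PureEquilibria.

Theorem proposition5 (R : realType) (K M : finType) (X : topologicalType)
    (G : game R K M X) (hK : #|K| = 2%N) :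
  exists (sigma : K -> M -> R) (tau : M -> X),
    partitional_equilibrium G sigma tau.
Proof.
have [|/nonemptyPn acc0] := pselect (acceptable G [set: K]%SET !=set0).
  exact: pooling_equilibrium.
apply: separating_equilibrium => j k jk.
have -> // : [set j; k]%SET = [set: K]%SET.
by apply/eqP; rewrite eqEcard finset.subsetT cardsT hK cards2 jk.
Qed.
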